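(* Let $G$ be a totally disconnected, locally compact group. All of the following are RIO subgroups of $G$: (i) any closed subgroup $H$ that acts distally on $G/H$ by translation (for example, any closed subnormal subgroup of $G$); (ii) any RIO subgroup of a RIO subgroup of $G$; (iii) any intersection of RIO subgroups of $G$; (iv) the closure of any pointwise limit inferior of RIO subgroups of $G$.
   Context: All topological groups are Hausdorff. A group is compactly generated if it is generated by a compact subset. A closed subgroup $H$ of $G$ is a RIO subgroup of $G$ if every compactly generated open subgroup of $H$ is an intersection of open subgroups of $G$. A group $H$ acts distally on a Hausdorff space $X$ by homeomorphisms if there do not exist distinct points $x,y\in X$, a net $(h_i)$ in $H$ and $z\in X$ with $h_ix\to z$ and $h_iy\to z$. In (i), $H$ acts on the left coset space $G/H$ by left translation. For a net $(H_i)_{i\in I}$ of subgroups of $G$, the (pointwise) limit inferior $\liminf (H_i)_{i\in I}$ is the set (in fact subgroup) of elements $g\in G$ such that there exists $i\in I$ for which $g\in H_j$ for all $j\ge i$. *)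

(* Defs.v *)
From HB Require Import structures.
From mathcomp Require Import all_boot.
From mathcomp Require Import all_classical topology.

Set Implicit Arguments.
Unset Strict Implicit.
Unset Printing Implicit Defensive.

Local Open Scope classical_set_scope.
Local Open Scope group_scope.
Local Open Scope quotient_scope.

(* The Hausdorff property is not part of the structure. *)
HB.mixin Record Group_isTopologicalGroup G & Group G & Topological G := {
  mulg_continuous : continuous (fun z : G * G => z.1 * z.2) ;
  invg_continuous : continuous (fun x : G => x^-1)
}.

#[short(type="topologicalGroupType")]
HB.structure Definition TopologicalGroup :=
  {G of Group G & Topological G & Group_isTopologicalGroup G}.

Section Subgroups.
Variable G : groupType.
Implicit Types H N X : set G.

Definition is_subgroup H : Prop :=
  [/\ H 1, forall x y, H x -> H y -> H (x * y) & forall x, H x -> H x^-1].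

Definition normal_in H N : Prop :=
  [/\ is_subgroup H, H `<=` N & forall x h, N x -> H h -> H (h ^ x)].

(* The terms of a subnormal series are not required to be closed. *)
Inductive subnormal : set G -> Prop :=
| subnormal_setT : subnormal setT
| subnormal_step H N : subnormal N -> normal_in H N -> subnormal H.

Definition generated X : set G := smallest is_subgroup X.

End Subgroups.

Definition directed_set (I : Type) (le : I -> I -> Prop) : Prop :=
  [/\ inhabited I,
      forall i, le i i,
      forall i j k, le i j -> le j k -> le i k &
      forall i j, exists k, le i k /\ le j k].

(* For u : I -> X, the net u converges to z iff u @ net_filter le --> z. *)
Definition net_filter (I : Type) (le : I -> I -> Prop) : set_system I :=
  [set A | exists i, forall j, le i j -> A j].

Definition net_liminf (T I : Type) (le : I -> I -> Prop) (A : I -> set T) :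
  set T := [set g | exists i, forall j, le i j -> A j g].

Definition acts_distally (G : Type) (X : topologicalType) (H : set G)
    (act : G -> X -> X) : Prop :=
  forall (x y z : X) (I : Type) (le : I -> I -> Prop) (h : I -> G),
    ~ [/\ x <> y,
          directed_set le,
          forall i, H (h i),
          (fun i => act (h i) x) @ net_filter le --> z &
          (fun i => act (h i) y) @ net_filter le --> z].

Section CosetSpace.
Variables (G : topologicalGroupType) (H : set G) (sgH : is_subgroup H).

Definition lcoset_rel : rel G := fun x y => `[< H (x^-1 * y) >].

Fact lcoset_rel_refl : reflexive lcoset_rel.
Proof. by case: sgH => H1 _ _ x; apply/asboolP; rewrite mulVg. Qed.

Fact lcoset_rel_sym : symmetric lcoset_rel.
Proof.
case: sgH => _ _ HV.
have sym x y : lcoset_rel x y -> lcoset_rel y x.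
  by move=> /asboolP /HV Hxy; apply/asboolP; rewrite invgM invgK in Hxy.
by move=> x y; apply/idP/idP; apply: sym.
Qed.

Fact lcoset_rel_trans : transitive lcoset_rel.
Proof.
case: sgH => _ HM _ y x z /asboolP Hxy /asboolP Hyz; apply/asboolP.
by have := HM _ _ Hxy Hyz; rewrite -mulgA mulVKg.
Qed.

Definition lcoset_equiv : equiv_rel G :=
  EquivRel lcoset_rel lcoset_rel_refl lcoset_rel_sym lcoset_rel_trans.

Definition lcoset_space : topologicalType :=
  quotient_topology {eq_quot lcoset_equiv}.

Definition lcoset_proj (x : G) : lcoset_space :=
  \pi_({eq_quot lcoset_equiv}) x.

(* Defined through representatives; lcoset_transl_proj is the usual rule. *)
Definition lcoset_transl (g : G) (q : lcoset_space) : lcoset_space :=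
  lcoset_proj (g * repr (q : {eq_quot lcoset_equiv})).

Lemma lcoset_projP (x y : G) : lcoset_proj x = lcoset_proj y <-> H (x^-1 * y).
Proof.
by split => [/eqmodP/asboolP//|Hxy]; apply/eqmodP/asboolP.
Qed.

Lemma lcoset_transl_proj (g x : G) :
  lcoset_transl g (lcoset_proj x) = lcoset_proj (g * x).
Proof.
apply/lcoset_projP; rewrite invgM -mulgA mulKg.
by apply/lcoset_projP; rewrite /lcoset_proj reprK.
Qed.

End CosetSpace.

Arguments lcoset_transl {G H} sgH g q.

Section RIO.
Variable G : topologicalGroupType.
Implicit Types A H K O U : set G.

Definition open_in A U : Prop := exists2 O, open O & U = A `&` O.

Definition closed_in A U : Prop := exists2 C, closed C & U = A `&` C.

Definition compactly_generated H : Prop :=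
  exists2 K, compact K & H = generated K.

(* The ambient group A carries the subspace topology of G, and the
   intersection of the empty family of subgroups of A is A. *)
Definition intersection_of_open_subgroups A U : Prop :=
  exists2 F : set (set G),
    (forall O, F O -> is_subgroup O /\ open_in A O) &
    U = A `&` \bigcap_(O in F) O.

(* H is a RIO subgroup of the topological group A, a subgroup of G. *)
Definition RIO A H : Prop :=
  [/\ is_subgroup H, closed_in A H &
      forall U, is_subgroup U -> open_in H U -> compactly_generated U ->
        intersection_of_open_subgroups A U].

End RIO.

(* Main.v *)
(**
For compact [K], let [R(K) = open_hull K] be the intersection of the open
subgroups of [G] containing [K]. A closed subgroup [H] is RIO iff
[R(K) `<=` H] for every compact [K `<=` H]. For "if": given a compactly generated
open subgroup [U] of [H], with compact generating set [K], a compact open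
subgroup [V] of [G] such that [R(K) `&` V `<=` U] satisfies [O `<=` V U] for some
open subgroup [O] containing [K]; hence [R(K) = U].

This criterion is stable under intersections and transitive. For the closure
[D] of a limit inferior [L], a compact subset [X] of [D] lies in a subgroup
[Gam (V `&` D)], where [Gam `<=` L] is finitely generated, so that [R(Gam) `<=` L],
and [V] is compact open; an open subgroup [O] containing [Gam] contains an open
subgroup normalised by [Gam (V `&` D)], so [R(X) `<=` O D].

If [H] acts distally on [G/H], then a compact open neighbourhood [Y] of the base
point contains a compact open set [E] invariant under [K], namely the largest
invariant subset of [Y] (Auslander, Glasner and Weiss): if it were not open, some
[z] outside [Y] would have an orbit under the group generated by [K] accumulating
on [E], and the Ellis-Numakura idempotent lemma would make [z] proximal to a point
of [E]. The stabiliser of [E] is an open subgroup containing [K].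
*)

Require Import Defs.
From mathcomp Require Import all_boot.
From mathcomp Require Import all_classical topology.
Local Open Scope classical_set_scope.

Set Implicit Arguments.
Unset Strict Implicit.
Unset Printing Implicit Defensive.

(** * Compactness and total disconnectedness *)

Section Compactness.
Implicit Types T S Z : topologicalType.

Definition filtered T (F : set (set T)) : Prop :=
  F !=set0 /\ forall A B, F A -> F B -> exists2 C, F C & C `<=` A `&` B.

(** If no [A] works, the traces on [K] of the members of [F], with [N] removed, generate a proper
    filter; a cluster point lies in every closed [A] but outside [N]. For empty [N] this is the
    finite intersection property. *)
Lemma filtered_compact_sub T (F : set (set T)) (K N : set T) :
  filtered F -> (forall A, F A -> closed A) -> compact K -> open N ->
  K `&` \bigcap_(A in F) A `<=` N -> exists2 A, F A & K `&` A `<=` N.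
Proof.
move=> [F0 FI] clF cK oN KN; apply: contrapT => noA.
pose B (A : set T) := K `&` A `&` ~` N.
have FF : Filter (filter_from F B).
  apply: filter_from_filter => // A1 A2 /FI FA1 /FA1 [A FA sA].
  by exists A => // x [[Kx /sA[? ?]] Nx].
have PF : ProperFilter (filter_from F B).
  apply: filter_from_proper => // A FA; apply: contrapT => B0.
  apply: noA; exists A => // x KAx; apply: contrapT => nNx.
  by apply: B0; exists x.
have [] := cK _ PF; first by have [A FA] := F0; exists A => // x [[]].
move=> p [Kp clp].
have clpB A : F A -> closure (B A) p.
  by move=> FA V pV; apply: clp => //; exists A.
have Np : N p.
  apply: KN; split=> // A FA; apply: (clF A FA).
  by apply: closureS (clpB A FA) => x [[]].
have [A FA] := F0.
have : (~` N) p.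
  apply: (open_closedC oN).
  by apply: closureS (clpB A FA) => x [].
exact.
Qed.

(** This is the tube lemma, obtained from the near-covering form of compactness. *)
Lemma open_forall_compact T S Z (f : T -> S -> Z) (K : set S) (W : set Z) :
  continuous (fun p : T * S => f p.1 p.2) -> compact K -> open W ->
  open [set t | forall s, K s -> W (f t s)].
Proof.
move=> cf /compact_near_coveringP cK oW; rewrite openE => t Wt.
apply: (cK _ (nbhs t) (fun t s => W (f t s))) => s Ks.
have /(cf (t, s)) : nbhs (f t s) W by apply: open_nbhs_nbhs; split=> //; exact: Wt.
case=> -[A B] [/= tA sB] AB; exists (B, A) => // -[s' t'] [/= Bs' At'].
by apply: (AB (t', s')).
Qed.

Lemma compact_finite_cover T (I : choiceType) (D : set I) (K : set T)
    (f : I -> set T) :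
  (forall i, D i -> open (f i)) -> K `<=` \bigcup_(i in D) f i -> compact K ->
  exists2 s : seq I, (forall i, i \in s -> D i) &
    forall x, K x -> exists2 i, i \in s & f i x.
Proof.
move=> opf Kf /compact_near_coveringP cK.
(* Finite lists in [D] are ordered by inclusion: near a point of [f i], every list containing [i]
   covers. *)
pose F := filter_from [set s : seq I | forall i, i \in s -> D i]
  (fun s => [set s' : seq I | (forall i, i \in s' -> D i) /\ {subset s <= s'}]).
have FF : Filter F.
  apply: filter_from_filter; first by exists [::].
  move=> s1 s2 D1 D2; exists (s1 ++ s2) => [i|s [Ds ss]].
    by rewrite mem_cat => /orP[/D1|/D2].
  by split; split=> // i si; apply: ss; rewrite mem_cat si ?orbT.
have [|s Ds /(_ s (conj Ds (fun i h => h))) Ks] :=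
  cK _ F (fun s x => exists2 i, i \in s & f i x) FF; last by exists s.
move=> x /Kf[i Di fx].
exists (f i, [set s' : seq I | i \in s']).
  split=> /=; first by apply: open_nbhs_nbhs; split=> //; exact: opf.
  exists [:: i] => [j|s [_]]; first by rewrite inE => /eqP ->.
  by apply; rewrite inE.
by case=> y s [/= fy si]; exists i.
Qed.

Lemma filtered_closure_nbhs T (F : set_system T) :
  Filter F -> filtered [set closure U | U in F].
Proof.
move=> FF; split; first by exists (closure setT), setT => //; exact: filterT.
move=> _ _ [A FA <-] [B FB <-]; exists (closure (A `&` B)).
  by exists (A `&` B) => //; exact: filterI.
exact: closureI.
Qed.

(** [filtered_compact_sub] is applied twice: to the closed neighbourhoods of one point of [A], then
    to the closed neighbourhoods of all of [B]. *)
Lemma hausdorff_compact_sep T (A B : set T) :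
  hausdorff_space T -> compact A -> compact B -> A `&` B = set0 ->
  exists U V, [/\ open U, open V, A `<=` U, B `<=` V & U `&` V = set0].
Proof.
move=> hT cA cB AB0.
have clos (F : set_system T) C : [set closure U | U in F] C -> closed C.
  by move=> [U _ <-]; exact: closed_closure.
have sepB a : A a -> exists2 U, nbhs a U & B `&` closure U `<=` set0.
  move=> Aa; have [|_ [U aU <-] UB] := filtered_compact_sub
    (filtered_closure_nbhs (nbhs_filter a)) (@clos _) cB open0.
    move=> b [Bb clb]; rewrite -AB0; split=> //; rewrite (_ : b = a) //.
    by apply/esym/hT => P Q aP bQ; have /(_ Q bQ) := clb _ (imageP _ aP).
  by exists U.
have [|_ [V BV <-] VA] := filtered_compact_sub
  (filtered_closure_nbhs (set_nbhs_filter B)) (@clos _) cA open0.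
  move=> a [Aa cla]; have [U aU UB] := sepB a Aa.
  have BV : set_nbhs B (~` closure U).
    apply/set_nbhsP; exists (~` closure U); split=> //.
      exact/closed_openC/closed_closure.
    by move=> b Bb Ub; exact: (UB b).
  have /(_ U aU)[y [nUy Uy]] := cla _ (imageP _ BV).
  exact: (nUy (subset_closure Uy)).
have /set_nbhsP[W [oW BW WV]] := BV.
exists (~` closure V), W; split=> //.
- exact/closed_openC/closed_closure.
- by move=> a Aa Va; exact: (VA a).
- by rewrite -subset0 => y [nVy /WV Vy]; exact: (nVy (subset_closure Vy)).
Qed.

(** The quasi-component [Q] of [x] in a compact neighbourhood [K] is connected, hence reduced to
    [x]. Compactness then puts a relatively clopen set containing [x] inside any given
    neighbourhood. *)
Lemma totally_disconnected_compact_open T (x : T) (W : set T) :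
  hausdorff_space T -> totally_disconnected [set: T] ->
  locally_compact [set: T] -> nbhs x W ->
  exists C, [/\ compact C, open C, C x & C `<=` W].
Proof.
move=> hT tdT lcT xW.
have [K xK [cK clK]] : exists2 K : set T, nbhs x K & compact K /\ closed K.
  have [K] := lcT x I; rewrite withinET => xK [cK clK].
  by exists K.
pose clop (C : set T) :=
  (exists2 O, open O & C = K `&` O) /\ (exists2 D, closed D & C = K `&` D).
have clopI A B : clop A -> clop B -> clop (A `&` B).
  move=> [[O1 oO1 A1] [D1 cD1 A2]] [[O2 oO2 B1] [D2 cD2 B2]]; split.
    by exists (O1 `&` O2); [exact: openI|rewrite A1 B1 setIACA setIid].
  by exists (D1 `&` D2); [exact: closedI|rewrite A2 B2 setIACA setIid].
pose F := [set C | clop C /\ C x].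
have Kx : K x by exact: nbhs_singleton.
have FK : F K.
  by split=> //; split; exists setT; rewrite ?setIT//; exact: openT.
have fF : filtered F.
  split; first by exists K.
  move=> A B [clA Ax] [clB Bx]; exists (A `&` B) => //.
  by split; [exact: clopI|].
have clF A : F A -> closed A.
  by move=> [[_ [D clD ->]] _]; apply: closedI.
pose Q := \bigcap_(A in F) A.
have Qx : Q x by move=> A [].
have QK : Q `<=` K by move=> y; apply.
have clQ : closed Q by apply: closed_bigI.
have cQ : compact Q by exact: subclosed_compact QK.
(* Disjoint open neighbourhoods [U], [V] of the two pieces of [Q] cover some relatively clopen [A].
   The part of [A] in [U] is again relatively clopen and contains [x], so it contains [Q]. *)
have sepQ (D1 D2 : set T) : closed D1 -> closed D2 -> Q `<=` D1 `|` D2 ->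
    Q `&` D1 `&` D2 = set0 -> D1 x -> Q `<=` D1.
  move=> cD1 cD2 QD D12 D1x.
  have cA : compact (Q `&` D1) by exact: compact_closedI.
  have cB : compact (Q `&` D2) by exact: compact_closedI.
  have [|U [V [oU oV AU BV UV]]] := hausdorff_compact_sep hT cA cB.
    by rewrite setIACA setIid setIA.
  have [|A FA KA] := filtered_compact_sub (N := U `|` V) fF clF cK (openU oU oV).
    move=> y [Ky Qy]; have [D1y|D2y] := QD y Qy; first by left; exact: AU.
    by right; exact: BV.
  have FAU : F (A `&` U).
    have [[[O oO AE] _] Ax] := FA.
    split; last by split=> //; apply: AU; split=> //; exact: Qx.
    split; first by exists (O `&` U); [exact: openI|rewrite AE setIA].
    have [[_ [D cD AD]] _] := FA.
    exists (D `&` ~` V); first by apply: closedI => //; exact: open_closedC.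
    rewrite setIA -AD; apply/seteqP; split=> y [Ay yU]; split=> //.
      by move=> Vy; have : set0 y by rewrite -UV.
    by have [] : (U `|` V) y by apply: KA; split=> //; move: Ay; rewrite AD => -[].
  move=> y Qy; have [//|D2y] := QD y Qy.
  have : set0 y by rewrite -UV; split; [have [] := Qy _ FAU|exact: BV].
  by [].
have conQ : connected Q.
  move=> B B0 [O oO BO] [D cD BD].
  have [Bx|nBx] := pselect (B x).
    rewrite {1}BD; apply: setIidl; apply: (sepQ _ (~` O)) => //.
    - exact: open_closedC.
    - move=> y Qy; have [Oy|nOy] := pselect (O y); last by right.
      by left; have : B y by [rewrite BO]; rewrite BD => -[].
    - by rewrite -BD BO -setIA setICr setI0.
    - by move: Bx; rewrite BD => -[].
  have QnO : Q `<=` ~` O.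
    apply: (sepQ _ D) => //.
    - exact: open_closedC.
    - move=> y Qy; have [Oy|nOy] := pselect (O y); last by left.
      by right; have : B y by [rewrite BO]; rewrite BD => -[].
    - by rewrite setIAC -BD BO -setIA setICr setI0.
    - by move=> Ox; apply: nBx; rewrite BO.
  by case: B0 => y; rewrite BO => -[/QnO].
have Q1 : Q `<=` [set x].
  by rewrite -(tdT x I); exact: connected_component_max.
(* Landing in the interior makes [A] open in [T] and not only relative to [K]. *)
have [|A FA KA] := filtered_compact_sub fF clF cK (open_interior (W `&` K)).
  move=> y [_ /Q1 ->]; exact: filterI.
exists A; have [[[O oO AO] _] Ax] := FA.
have AK : A `<=` K by rewrite AO; exact: subIsetl.
have AN : A `<=` (W `&` K)° by move=> y Ay; apply: KA; split=> //; exact: AK.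
split=> //.
- by apply: subclosed_compact (clF _ FA) cK AK.
- rewrite (_ : A = (W `&` K)° `&` O); first by apply: openI => //; exact: open_interior.
  apply/seteqP; split=> y.
    by move=> Ay; split; [exact: AN|move: Ay; rewrite AO => -[]].
  by move=> [/interior_subset[_ Ky] Oy]; rewrite AO.
- by move=> y /AN/interior_subset[].
Qed.

End Compactness.

(** * Topological groups *)

Section SubgroupTheory.
Local Open Scope group_scope.
Variable G : groupType.
Implicit Types H K L X : set G.

Lemma generated_subgroup X : is_subgroup (generated X).
Proof.
split=> [M [[]]//|x y gx gy M [sM XM]|x gx M [sM XM]].
  by have [_ sMM _] := sM; apply: sMM; [exact: gx|exact: gy].
by have [_ _ sMV] := sM; apply: sMV; exact: gx.
Qed.

Lemma sub_generated X : X `<=` generated X.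
Proof. exact: sub_gen_smallest. Qed.

Lemma generated_sub X H : is_subgroup H -> X `<=` H -> generated X `<=` H.
Proof. exact: smallest_sub. Qed.

Lemma subgroupI H K : is_subgroup H -> is_subgroup K -> is_subgroup (H `&` K).
Proof.
move=> [H1 HM HV] [K1 KM KV]; split=> // [x y [Hx Kx] [Hy Ky]|x [Hx Kx]].
  by split; [exact: HM|exact: KM].
by split; [exact: HV|exact: KV].
Qed.

Lemma subgroup_bigcap (F : set (set G)) :
  (forall H, F H -> is_subgroup H) -> is_subgroup (\bigcap_(H in F) H).
Proof.
move=> sF; split=> [H /sF[]//|x y Fx Fy H FH|x Fx H FH].
  by have [_ HM _] := sF H FH; apply: HM; [exact: Fx|exact: Fy].
by have [_ _ HV] := sF H FH; apply: HV; exact: Fx.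
Qed.

(** Imposing the inclusion for [g] and for [g^-1] gives the setwise stabiliser; for a continuous
    action and a compact open [E], each half is an open condition by the tube lemma. *)
Definition stabilizer (T : Type) (act : G -> T -> T) (E : set T) : set G :=
  [set g | (forall x, E x -> E (act g x)) /\ (forall x, E x -> E (act g^-1 x))].

Lemma stabilizer_subgroup (T : Type) (act : G -> T -> T) (E : set T) :
  (forall x, act 1 x = x) -> (forall g h x, act (g * h) x = act g (act h x)) ->
  is_subgroup (stabilizer act E).
Proof.
move=> act1 actM; split.
- by split=> x; rewrite ?invg1 act1.
- move=> g h [Eg EgV] [Eh EhV]; split=> x Ex; first by rewrite actM; auto.
  by rewrite invgM actM; auto.
- by move=> g [Eg EgV]; split; rewrite ?invgK.
Qed.

Definition mulset H K : set G := [set h * k | h in H & k in K].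

Lemma mulset_subgroup H K :
  is_subgroup H -> is_subgroup K ->
  (forall k h, K k -> H h -> mulset H K (k * h)) -> is_subgroup (mulset H K).
Proof.
move=> [H1 HM HV] [K1 KM KV] KH; split.
- by exists 1 => //; exists 1 => //; rewrite mulg1.
- move=> _ _ [h Hh [k Kk <-]] [h' Hh' [k' Kk' <-]].
  have [h2 Hh2 [k2 Kk2 E]] := KH _ _ Kk Hh'.
  exists (h * h2); first exact: HM.
  by exists (k2 * k'); [exact: KM|rewrite mulgA -(mulgA h) E !mulgA].
- by move=> _ [h Hh [k Kk <-]]; rewrite invgM; apply: KH; [exact: KV|exact: HV].
Qed.

End SubgroupTheory.

Section TopologicalGroupTheory.
Local Open Scope group_scope.
Variable G : topologicalGroupType.
Implicit Types H K L O V W X : set G.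

Lemma continuousMg (T : topologicalType) (f g : T -> G) :
  continuous f -> continuous g -> continuous (fun x => f x * g x).
Proof.
move=> cf cg x; apply: (@continuous_comp _ _ _ (fun x => (f x, g x))
  (fun z : G * G => z.1 * z.2)); last exact: mulg_continuous.
by apply: cvg_pair; [exact: cf|exact: cg].
Qed.

Lemma continuousVg (T : topologicalType) (f : T -> G) :
  continuous f -> continuous (fun x => (f x)^-1).
Proof.
move=> cf x; apply: (@continuous_comp _ _ _ f (fun z : G => z^-1)).
  exact: cf.
exact: invg_continuous.
Qed.

Lemma open_preim (S T : topologicalType) (f : S -> T) (A : set T) :
  continuous f -> open A -> open (f @^-1` A).
Proof. by move=> /continuousP; apply. Qed.

Lemma continuous_idfun (T : topologicalType) : continuous (fun x : T => x).
Proof. by move=> x; exact: cvg_id. Qed.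

Lemma continuous_fst (S T : topologicalType) : continuous (@fst S T).
Proof. by move=> p; exact: cvg_fst. Qed.

Lemma continuous_snd (S T : topologicalType) : continuous (@snd S T).
Proof. by move=> p; exact: cvg_snd. Qed.

Lemma open_ltransl g V : open V -> open [set x | V (g * x)].
Proof.
apply: open_preim; apply: continuousMg; [exact: cst_continuous|exact: continuous_idfun].
Qed.

Lemma open_rtransl g V : open V -> open [set x | V (x * g)].
Proof.
apply: open_preim; apply: continuousMg; [exact: continuous_idfun|exact: cst_continuous].
Qed.

(** This serves to prove that [g] is in a closed subgroup [D]: if [g] lies in [V D] with [V] inside
    this set, some [v^-1 * g] lies in both [D] and [B]. *)
Lemma nbhs_invg_transl g B : nbhs g B -> nbhs 1 [set w : G | B (w^-1 * g)].
Proof.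
have c : continuous (fun w : G => w^-1 * g).
  by apply: continuousMg; [exact: invg_continuous|exact: cst_continuous].
by move=> Bg; apply: c; rewrite invg1 mul1g.
Qed.

Lemma closure_preim (S T : topologicalType) (f : S -> T) (A : set S) (B : set T) x :
  continuous f -> (forall a, A a -> B (f a)) -> closure A x -> closure B (f x).
Proof.
by move=> cf AB clx W /cf/clx [a [/AB Ba Wa]]; exists (f a).
Qed.

Lemma closure_subgroup H : is_subgroup H -> is_subgroup (closure H).
Proof.
move=> [H1 HM HV].
have HM' h x : H h -> closure H x -> closure H (h * x).
  move=> Hh.
  apply: (closure_preim (f := fun z => h * z) (A := H)) => [|a]; last exact: HM.
  by apply: continuousMg; [exact: cst_continuous|exact: continuous_idfun].
split; first exact: subset_closure.
- move=> x y clx cly; rewrite ((closure_id _).1 (@closed_closure _ H)).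
  apply: (closure_preim (f := fun z => z * y) (A := H)) clx => [|a Ha].
    by apply: continuousMg; [exact: continuous_idfun|exact: cst_continuous].
  exact: HM'.
- move=> x; apply: (closure_preim (f := fun z => z^-1)) => //.
  exact: invg_continuous.
Qed.

Lemma subgroup_open H : is_subgroup H -> nbhs 1 H -> open H.
Proof.
move=> [H1 HM HV] nH; rewrite openE => h Hh.
have : nbhs (h^-1 * h) H by rewrite mulVg.
have c : continuous (fun x : G => h^-1 * x).
  by apply: continuousMg; [exact: cst_continuous|exact: continuous_idfun].
move=> /c nhH; apply: (@filterS _ (nbhs h) _ _ H _ nhH) => x /= Hx.
by rewrite -(mulVKg h x); apply: HM.
Qed.

Lemma open_subgroup_closed H : is_subgroup H -> open H -> closed H.
Proof.
move=> [H1 HM HV] oH x clx.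
have /clx[y [Hy Hxy]] : nbhs x [set y | H (x^-1 * y)].
  apply: open_nbhs_nbhs; split; first exact: open_ltransl.
  by rewrite /= mulVg.
rewrite (_ : x = y * (x^-1 * y)^-1); first exact: HM _ (HV _ Hxy).
by rewrite invgM invgK mulVKg.
Qed.

Lemma stabilizer_open (T : topologicalType) (act : G -> T -> T) (E : set T) :
  continuous (fun p : G * T => act p.1 p.2) -> compact E -> open E ->
  open (stabilizer act E).
Proof.
move=> cact cE oE.
have cactV : continuous (fun p : G * T => act p.1^-1 p.2).
  move=> p; apply: (@continuous_comp _ _ _ (fun p : G * T => (p.1^-1, p.2))
    (fun p : G * T => act p.1 p.2)); last exact: cact.
  apply: cvg_pair; last exact: cvg_snd.
  by apply: continuousVg; exact: continuous_fst.
exact: openI (open_forall_compact cact cE oE) (open_forall_compact cactV cE oE).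
Qed.

(** Van Dantzig's theorem: the stabiliser under left translation of a compact open neighbourhood [C]
    of 1 is open, and it lies in [C] because it moves 1 within [C]. *)
Lemma compact_open_subgroup W :
  hausdorff_space G -> totally_disconnected [set: G] ->
  locally_compact [set: G] -> nbhs 1 W ->
  exists V, [/\ is_subgroup V, compact V, open V & V `<=` W].
Proof.
move=> hT tdT lcT nW.
have [C [cC oC C1 CW]] := totally_disconnected_compact_open hT tdT lcT nW.
pose V := stabilizer (fun g x : G => g * x) C.
have sV : is_subgroup V by apply: stabilizer_subgroup => *; rewrite ?mul1g ?mulgA.
have VC : V `<=` C by move=> g [/(_ 1 C1)]; rewrite mulg1.
have oV : open V.
  by apply: stabilizer_open => //; exact: mulg_continuous.
exists V; split=> //; last exact: subset_trans CW.
exact: subclosed_compact (open_subgroup_closed sV oV) cC VC.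
Qed.

(** Both directions of conjugation are imposed because [K] need not be symmetric. As [K] need not
    contain 1, the core need not lie in [V]. *)
Definition conj_core K V : set G :=
  [set v | (forall k, K k -> V (k * v * k^-1)) /\
           (forall k, K k -> V (k^-1 * v * k))].

Lemma open_conj_core K V : compact K -> open V -> open (conj_core K V).
Proof.
move=> cK oV.
have c1 : continuous (fun p : G * G => p.2 * p.1 * p.2^-1).
  apply: continuousMg; last by apply: continuousVg; exact: continuous_snd.
  by apply: continuousMg; [exact: continuous_snd|exact: continuous_fst].
have c2 : continuous (fun p : G * G => p.2^-1 * p.1 * p.2).
  apply: continuousMg; last exact: continuous_snd.
  apply: continuousMg; last exact: continuous_fst.
  by apply: continuousVg; exact: continuous_snd.
exact: openI (open_forall_compact (f := fun v k => k * v * k^-1) c1 cK oV)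
  (open_forall_compact (f := fun v k => k^-1 * v * k) c2 cK oV).
Qed.

Lemma conj_core1 K V : V 1 -> conj_core K V 1.
Proof. by move=> V1; split=> k Kk; rewrite mulg1 ?mulgV ?mulVg. Qed.

Definition open_hull K : set G :=
  [set g | forall O, is_subgroup O -> open O -> K `<=` O -> O g].

Lemma open_hull_subgroup K : is_subgroup (open_hull K).
Proof.
split=> [O [] //|x y Kx Ky O sO oO KO|x Kx O sO oO KO].
  by have [_ OM _] := sO; apply: OM; [exact: Kx|exact: Ky].
by have [_ _ OV] := sO; apply: OV; exact: Kx.
Qed.

Lemma sub_open_hull K : K `<=` open_hull K.
Proof. by move=> k Kk O _ _; apply. Qed.

(* Compactness yields an open subgroup [O] with [O & V] inside [V' (hull & V)],
   where [V' = conj_core K V]; then [(O & V) L] is left invariant under both [K]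
   and [O & V]. *)
Lemma open_subgroup_sub_mulset K V L :
  compact K -> is_subgroup V -> compact V -> open V -> is_subgroup L ->
  K `<=` L -> open_hull K `&` V `<=` L ->
  exists O, [/\ is_subgroup O, open O, K `<=` O & O `<=` mulset V L].
Proof.
move=> cK sV cV oV sL KL RL.
pose V' := conj_core K V.
have oV' : open V' by exact: open_conj_core.
have [V1 VM VV] := sV; have [L1 LM LV] := sL.
have V'1 : V' 1 by exact: conj_core1.
(* [N] is an open neighbourhood of the trace of the hull on [V]. This trace is a filtered
   intersection of traces of open, hence closed, subgroups, so one of them already lies in [N]. *)
pose N := \bigcup_(r in open_hull K `&` V) [set x | V' (x * r^-1)].
have oN : open N by apply: bigcup_open => r _; exact: open_rtransl.
pose F := [set O : set G | [/\ is_subgroup O, open O & K `<=` O]].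
have fF : filtered F.
  split; first by exists setT; split=> //; exact: openT.
  move=> A B [sA oA KA] [sB oB KB]; exists (A `&` B) => //; split.
  - exact: subgroupI.
  - exact: openI.
  - by move=> k Kk; split; [exact: KA|exact: KB].
have clF A : F A -> closed A.
  by move=> [sA oA _]; exact: open_subgroup_closed.
have [|O [sO oO KO] VON] := filtered_compact_sub fF clF cV oN.
  move=> x [Vx Fx]; exists x; last by rewrite /= mulgV.
  by split=> // A sA oA KA; apply: Fx.
have [O1 OM OV] := sO.
pose T := mulset (V `&` O) L.
have TVO g : (V `&` O) g -> forall x, T x -> T (g * x).
  move=> [Vg Og] _ [v [Vv Ov] [l Ll <-]]; exists (g * v).
    by split; [exact: VM|exact: OM].
  by exists l => //; rewrite mulgA.
(* The splitting [k v l = (k (v r^-1) k^-1) (k r l)] is used, with [r] in the hull and in [V]. The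
   first factor is in [V] because [v r^-1] is in [V'], and in [O] because the hull is; [r] lies in
   [L] by hypothesis. *)
have TK k : L k -> O k -> (forall v, V' v -> V (k * v * k^-1)) ->
    forall x, T x -> T (k * x).
  move=> Lk Ok kV _ [v [Vv Ov] [l Ll <-]].
  have [r [Rr Vr] V'vr] := VON v (conj Vv Ov).
  exists (k * (v * r^-1) * k^-1).
    split; first exact: kV.
    have Or : O r by exact: Rr.
    by apply: (OM); [apply: (OM) => //; apply: OM => //|]; exact: OV.
  exists (k * (r * l)); first by apply: (LM) => //; apply: LM => //; exact: RL.
  by rewrite !mulgA mulgVK mulgVK.
exists (stabilizer (fun g x : G => g * x) T).
have sS : is_subgroup (stabilizer (fun g x : G => g * x) T).
  by apply: stabilizer_subgroup => *; rewrite ?mul1g ?mulgA.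
split=> //.
- apply: subgroup_open => //; have oVO := openI oV oO.
  apply: (@filterS _ _ _ (V `&` O)); last by apply: open_nbhs_nbhs.
  by move=> g [Vg Og]; split; apply: TVO; split=> //; [exact: VV|exact: OV].
- move=> k Kk; split; apply: TK.
  + exact: KL.
  + exact: KO.
  + by move=> v [/(_ k Kk)].
  + by apply: LV; exact: KL.
  + by apply: OV; exact: KO.
  + by move=> v [_ /(_ k Kk)]; rewrite invgK.
- move=> g [/(_ 1)]; rewrite mulg1 => gT _.
  have [|v [Vv _] [l Ll <-]] := gT; last by exists v => //; exists l.
  by exists 1 => //; exists 1 => //; rewrite mulg1.
Qed.

End TopologicalGroupTheory.

(** * RIO subgroups *)

Section RIOTheory.
Local Open Scope group_scope.
Variable G : topologicalGroupType.
Hypotheses (hausG : hausdorff_space G)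
  (tdG : totally_disconnected [set: G]) (lcG : locally_compact [set: G]).
Implicit Types A H K L O U V W X : set G.

Let compact_open W (nW : nbhs 1 W) := compact_open_subgroup hausG tdG lcG nW.

Lemma open_inT O : open_in [set: G] O -> open O.
Proof. by move=> [W oW ->]; rewrite setTI. Qed.

Lemma RIO_closed H : RIO [set: G] H -> closed H.
Proof. by move=> [_ [C cC ->] _]; rewrite setTI. Qed.

(* [O] need not be compactly generated: the hypothesis is applied to the
   subgroup generated by [K] and a compact neighbourhood of 1 in [H]. *)
Lemma RIO_open_subgroup A H O K :
  closed H -> RIO A H -> is_subgroup O -> open_in H O -> compact K -> K `<=` O ->
  exists2 F : set (set G),
    (forall P, F P -> [/\ is_subgroup P, open_in A P & K `<=` P]) &
    A `&` \bigcap_(P in F) P `<=` O.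
Proof.
move=> clH [sH _ ioH] sO [W oW OE] cK KO.
have [O1 OM OV] := sO.
have W1 : nbhs 1 W.
  by apply: open_nbhs_nbhs; split=> //; move: O1; rewrite OE => -[].
have [V [sV cV oV VW]] := compact_open W1.
pose U := generated (K `|` (H `&` V)).
have sU : is_subgroup U by exact: generated_subgroup.
have [U1 UM UV] := sU.
have KU : K `|` (H `&` V) `<=` U by exact: sub_generated.
have UO : U `<=` O.
  apply: generated_sub => // x [/KO//|[Hx /VW Wx]].
  by rewrite OE.
have [||F oF UE] := ioH U sU.
- exists (\bigcup_(u in U) [set x | V (u^-1 * x)]).
    by apply: bigcup_open => u _; exact: open_ltransl.
  apply/seteqP; split=> x.
    move=> Ux; split; first by have := UO x Ux; rewrite OE => -[].
    by exists x => //=; rewrite mulVg; have [] := sV.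
  move=> [Hx [u Uu /= Vux]]; rewrite -(mulVKg u x); apply: UM => //.
  apply: KU; right; split=> //.
  have [_ HM HV] := sH; apply: HM => //; apply: HV.
  by have := UO u Uu; rewrite OE => -[].
- exists (K `|` (H `&` V)) => //; apply: compactU => //.
  by rewrite setIC; exact: compact_closedI.
- exists F; last by rewrite -UE.
  move=> P FP; have [sP oP] := oF P FP; split=> // x Kx.
  have : U x by apply: KU; left.
  by rewrite UE => -[_]; apply.
Qed.

(** Transitivity needs this for open subgroups [O] of [H], and not for [H] alone. *)
Lemma RIO_open_hull H O K :
  RIO [set: G] H -> is_subgroup O -> open_in H O -> compact K -> K `<=` O ->
  open_hull K `<=` O.
Proof.
move=> rH sO oO cK KO.
have [F FP FO] := RIO_open_subgroup (RIO_closed rH) rH sO oO cK KO.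
apply: subset_trans FO => g Kg; split=> // P /FP[sP oP KP].
by apply: Kg => //; exact: open_inT.
Qed.

Lemma RIO_open_hull_sub H K :
  RIO [set: G] H -> compact K -> K `<=` H -> open_hull K `<=` H.
Proof.
move=> rH cK KH; have [sH _ _] := rH; apply: (RIO_open_hull rH) => //.
by exists setT; [exact: openT|rewrite setIT].
Qed.

Lemma RIO_of_open_hull H :
  is_subgroup H -> closed H ->
  (forall K, compact K -> K `<=` H -> open_hull K `<=` H) -> RIO [set: G] H.
Proof.
move=> sH clH hullH; split=> //; first by exists H => //; rewrite setTI.
move=> U sU [W oW UE] [K cK UK].
have [U1 UM UV] := sU.
have KU : K `<=` U by rewrite UK; exact: sub_generated.
exists [set P | [/\ is_subgroup P, open_in setT P & U `<=` P]].
  by move=> P [sP oP _]; split.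
rewrite setTI; apply/seteqP; split=> [x Ux P [_ _]|g Fg]; first by apply.
have UR : U `<=` open_hull K.
  by rewrite UK; apply: generated_sub; [exact: open_hull_subgroup|exact: sub_open_hull].
have Rg : open_hull K g.
  move=> P sP oP KP; apply: Fg; split=> //; first by exists P => //; rewrite setTI.
  by rewrite UK; exact: generated_sub.
have W1 : nbhs 1 W.
  by apply: open_nbhs_nbhs; split=> //; move: U1; rewrite UE => -[].
have [V [sV cV oV VW]] := compact_open W1.
have KH : K `<=` H by move=> k /KU; rewrite UE => -[].
have RVU : open_hull K `&` V `<=` U.
  by move=> x [/(hullH K cK KH) Hx /VW Wx]; rewrite UE.
have [O [sO oO KO OVU]] := open_subgroup_sub_mulset cK sV cV oV sU KU RVU.
have [v Vv [u Uu gE]] := OVU g (Rg O sO oO KO).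
(* From [g = v u] with [g] and [u] in the hull, [v] lies in the hull and in [V], hence in [U]. *)
rewrite -gE; apply: (UM) => //; apply: RVU; split=> //.
have [_ RM RV] := open_hull_subgroup K.
by rewrite -(mulgK u v) gE; apply: RM => //; apply: RV; exact: UR.
Qed.

(** For compact [X] in [K], open subgroups [P] of [H] containing [X] have intersection inside [K];
    each [P] contains the hull of [X] because [H] is RIO in [G]. *)
Lemma RIO_trans H K : RIO [set: G] H -> RIO H K -> RIO [set: G] K.
Proof.
move=> rH rK; have clH := RIO_closed rH.
have clK : closed K by have [_ [C cC ->] _] := rK; exact: closedI.
have [sK _ _] := rK.
apply: RIO_of_open_hull => // X cX XK.
have [|F FP FK] := RIO_open_subgroup clK rK sK _ cX XK.
  by exists setT; [exact: openT|rewrite setIT].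
have KH : K `<=` H by have [_ [C _ ->] _] := rK => x [].
apply: subset_trans FK => g Xg; split.
  by apply: (RIO_open_hull_sub rH cX) => // x /XK/KH.
by move=> P /FP[sP oP XP]; exact: (RIO_open_hull rH sP oP cX XP).
Qed.

Lemma RIO_bigcap (F : set (set G)) :
  (forall H, F H -> RIO [set: G] H) -> RIO [set: G] (\bigcap_(H in F) H).
Proof.
move=> rF; apply: RIO_of_open_hull.
- by apply: subgroup_bigcap => H /rF[].
- by apply: closed_bigI => H /rF/RIO_closed.
- move=> K cK KF g Kg H FH; apply: (RIO_open_hull_sub (rF H FH) cK) => // k Kk.
  exact: KF.
Qed.

(** * Closures of limits inferior *)

Section Liminf.
Variables (J : Type) (le : J -> J -> Prop) (H_ : J -> set G).
Hypotheses (dle : directed_set le) (rH : forall i, RIO [set: G] (H_ i)).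
Let L := net_liminf le H_.

Lemma net_liminf_subgroup : is_subgroup L.
Proof.
have [[i0] _ le_trans le_ub] := dle.
have sH i : is_subgroup (H_ i) by have [] := rH i.
split; first by exists i0 => j _; have [] := sH j.
- move=> x y [i Hx] [j Hy]; have [k [ik jk]] := le_ub i j.
  exists k => l kl; have [_ HM _] := sH l.
  by apply: HM; [apply: Hx; exact: le_trans kl|apply: Hy; exact: le_trans kl].
- move=> x [i Hx]; exists i => j ij; have [_ _ HV] := sH j.
  by apply: HV; exact: Hx.
Qed.

(** By directedness, finitely many elements of [L] lie in [H_ j] simultaneously from some index on.
    A finite set is compact, so each such [H_ j] contains its hull. *)
Lemma open_hull_net_liminf (s : seq G) :
  (forall x, x \in s -> L x) -> open_hull [set` s] `<=` L.
Proof.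
have [[i0] lexx le_trans le_ub] := dle => sL.
have [i Hi] : exists i, forall x, x \in s -> forall j, le i j -> H_ j x.
  elim: s sL => [|x s IHs] sL; first by exists i0.
  have [|i Hi] := IHs; first by move=> y sy; apply: sL; rewrite inE sy orbT.
  have [|j Hj] := sL x; first by rewrite inE eqxx.
  have [k [ik jk]] := le_ub i j; exists k => y; rewrite inE => /orP[/eqP ->|sy] l kl.
    by apply: Hj; exact: le_trans kl.
  by apply: Hi => //; exact: le_trans kl.
move=> g sg; exists i => j ij.
apply: (RIO_open_hull_sub (rH j) _ _ sg); last by move=> x /= sx; exact: Hi.
exact/finite_compact/finite_seq.
Qed.

Lemma RIO_closure_liminf : RIO [set: G] (closure L).
Proof.
have sL := net_liminf_subgroup.
have sD := closure_subgroup sL.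
have [L1 LM LV] := sL; have [D1 DM DV] := sD; set D := closure L in D1 DM DV *.
have LD : L `<=` D by exact: subset_closure.
have clD : closed D by exact: closed_closure.
apply: RIO_of_open_hull => // X cX XD g Xg.
have [V [sV cV oV _]] := compact_open filterT.
have [V1 VM VV] := sV.
pose VD := V `&` D.
have cVD : compact VD by exact: compact_closedI.
have sVD : is_subgroup VD by exact: subgroupI.
have [VD1 VDM VDV] := sVD.
have dense (U W : set G) x : open U -> U 1 -> open W -> W x -> D x ->
    exists2 l, L l & W l /\ U (l^-1 * x).
  move=> oU U1 oW Wx clx; have oU' : open [set y | U (y^-1 * x)].
    apply: (open_preim _ oU); apply: continuousMg; last exact: cst_continuous.
    exact: invg_continuous.
  have /clx[l [Ll [Ul Wl]]] : nbhs x ([set y | U (y^-1 * x)] `&` W).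
    apply: open_nbhs_nbhs; split; first exact: openI.
    by split=> //=; rewrite mulVg.
  by exists l.
(* The finite set [s] gives [X] inside [s V]; the finite set [t] below gives [V & D] inside [t V'].
   Together they generate [Gam], and [D' = Gam (V & D)] will be a subgroup containing [X]. *)
have [||s sL' Xs] := compact_finite_cover (D := L) (K := X)
    (f := fun l => [set x | V (l^-1 * x)]) _ _ cX.
- by move=> l _; exact: open_ltransl.
- by move=> x /XD/(dense V setT x oV V1 openT I)[l Ll [_ Vl]]; exists l.
pose V' := conj_core [set` s] V.
have oV' : open V' by apply: open_conj_core => //; exact/finite_compact/finite_seq.
have V'1 : V' 1 by exact: conj_core1.
have [||t tVL VDt] := compact_finite_cover (D := V `&` L) (K := VD)
    (f := fun f => [set x | V' (f^-1 * x)]) _ _ cVD.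
- by move=> f _; exact: open_ltransl.
- by move=> x [Vx /(dense V' V x oV' V'1 oV Vx)[l Ll [Vl Ul]]]; exists l.
pose Y := [set` s ++ t].
have stL x : x \in s ++ t -> L x.
  by rewrite mem_cat => /orP[/sL'|/tVL[]].
pose Gam := generated Y.
have sGam : is_subgroup Gam by exact: generated_subgroup.
have [G1 GM GV] := sGam.
have YG : Y `<=` Gam by exact: sub_generated.
have GL : Gam `<=` L by apply: generated_sub => // x; exact: stL.
pose D' := mulset Gam VD.
have GD' x y : Gam x -> D' y -> D' (x * y).
  move=> Gx [a Ga [b Vb <-]]; exists (x * a); first exact: GM.
  by exists b => //; rewrite mulgA.
have VDG : forall v x, VD v -> Gam x -> D' (v * x).
  (* Treating [x] and [x^-1] together makes the right-hand side a subgroup, so only generators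
     remain to be checked. *)
  suff : Gam `<=` [set x | Gam x /\ forall v, VD v -> D' (v * x) /\ D' (v * x^-1)].
    by move=> h v x Vv /h[_ /(_ v Vv)[]].
  apply: generated_sub.
    split.
    - split=> // v Vv; rewrite invg1 mulg1.
      by split; exists 1 => //; exists v => //; rewrite mul1g.
    - move=> x y [Gx hx] [Gy hy]; split; first exact: GM.
      move=> v Vv; rewrite invgM !mulgA; split.
        have [[a Ga [b Vb <-]] _] := hx v Vv; rewrite -mulgA; apply: GD' => //.
        by have [] := hy b Vb.
      have [_ [a Ga [b Vb <-]]] := hy v Vv; rewrite -mulgA; apply: GD' => //.
      by have [] := hx b Vb.
    - move=> x [Gx hx]; split; first exact: GV.
      by move=> v /hx[]; rewrite invgK.
  move=> x Yx; split; first exact: YG.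
  move=> v Vv; have [f tf V'f] := VDt v Vv.
  have [Vf Lf] := tVL f tf.
  have Gf : Gam f by apply: YG; rewrite /Y /= mem_cat tf orbT.
  have Gx := YG _ Yx.
  have Df : D (f^-1 * v) by apply: DM; [apply: DV; exact: LD|case: Vv].
  move: Yx; rewrite /Y /= mem_cat => /orP[sx|tx].
    have Dx : D x by apply: LD; exact: sL'.
    (* With [v = f (f^-1 v)], one has [v x = (f x) (x^-1 (f^-1 v) x)]; the last factor is in [V]
       because [f^-1 v] is in [V']. *)
    have [h1 h2] := V'f; split.
      exists (f * x); first exact: GM.
      exists (x^-1 * (f^-1 * v) * x); last by rewrite !mulgA mulgK mulgV mul1g.
      split; first exact: h2.
      by apply: (DM) => //; apply: DM => //; exact: DV.
    exists (f * x^-1); first by apply: GM => //; exact: GV.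
    exists (x * (f^-1 * v) * x^-1); last by rewrite !mulgA mulgVK mulgV mul1g.
    split; first exact: h1.
    by apply: (DM); [apply: DM|exact: DV].
  have Vx : VD x by have [? ?] := tVL x tx; split=> //; exact: LD.
  split; exists 1 => //.
    by exists (v * x); [exact: VDM|rewrite mul1g].
  by exists (v * x^-1); [apply: VDM => //; exact: VDV|rewrite mul1g].
have sD' : is_subgroup D' by exact: mulset_subgroup.
have [D'1 D'M D'V] := sD'.
have D'D : D' `<=` D.
  by move=> _ [x /GL/LD Dx [y [_ Dy] <-]]; exact: DM.
have XD' : X `<=` D'.
  move=> x Xx; have [l sl Vl] := Xs x Xx.
  exists l; first by apply: YG; rewrite /Y /= mem_cat sl.
  exists (l^-1 * x); last by rewrite mulVKg.
  by split=> //; apply: DM; [apply: DV; apply: LD; exact: sL'|exact: XD].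
apply: clD => B Bg.
have [V2 [sV2 cV2 oV2 V2B]] := compact_open (nbhs_invg_transl Bg).
have cY : compact Y by exact/finite_compact/finite_seq.
have YD : Y `<=` D by move=> y /stL/LD.
have [|O [sO oO YO OVD]] := open_subgroup_sub_mulset cY sV2 cV2 oV2 sD YD.
  by move=> x [/(open_hull_net_liminf stL)/LD].
have [O1 OM OV] := sO.
have GO : Gam `<=` O by exact: generated_sub.
(* [P] is the intersection of the conjugates of [O] by [V & D], open by compactness. Since [Gam]
   lies in [O], the group [D'] normalises [P]. *)
pose P := [set p | forall v, VD v -> O (v^-1 * p * v)].
have oP : open P.
  apply: (open_forall_compact (f := fun p v => v^-1 * p * v)) => //.
  apply: continuousMg; last exact: continuous_snd.
  apply: continuousMg; last exact: continuous_fst.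
  by apply: continuousVg; exact: continuous_snd.
have PO : P `<=` O by move=> p /(_ 1 VD1); rewrite invg1 mul1g mulg1.
have sP : is_subgroup P.
  split.
  - by move=> v Vv; rewrite mulg1 mulVg.
  - move=> p q Pp Pq v Vv.
    rewrite (_ : _ * v = (v^-1 * p * v) * (v^-1 * q * v)); last by rewrite !mulgA mulgK.
    by apply: OM; [exact: Pp|exact: Pq].
  - move=> p Pp v Vv; rewrite (_ : _ * v = (v^-1 * p * v)^-1).
      by apply: OV; exact: Pp.
    by rewrite !invgM invgK mulgA.
have PD' d p : D' d -> P p -> P (d * p * d^-1).
  move=> D'd Pp v Vv.
  (* Moving [v^-1 d] into the form [x w] turns the conjugate into one of [w p w^-1], which is in
     [O], by [x] in [Gam], which is also in [O]. *)
  have [x Gx [w Vw E]] : D' (v^-1 * d).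
    apply: D'M => //; exists 1 => //.
    by exists v^-1; [exact: VDV|rewrite mul1g].
  rewrite (_ : _ * v = x * (w * p * w^-1) * x^-1).
    apply: (OM); last by apply: OV; exact: GO.
    apply: OM; first exact: GO.
    by have := Pp _ (VDV _ Vw); rewrite invgK.
  have -> : d = v * (x * w) by rewrite E mulVKg.
  by rewrite !invgM !mulgA mulVg mul1g mulgVK.
have sPD : is_subgroup (mulset P D').
  apply: mulset_subgroup => // d p D'd Pp; exists (d * p * d^-1); first exact: PD'.
  by exists d => //; rewrite mulgVK.
have P1 : P 1 by case: sP.
have oPD : open (mulset P D').
  apply: subgroup_open => //; apply: (@filterS _ (nbhs (1 : G)) _ P).
    by move=> p Pp; exists p => //; exists 1 => //; rewrite mulg1.
  exact: open_nbhs_nbhs.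
(* The open subgroup [P D'] contains [X], hence [g]. Then [g = v d d'] with [v] in [V2], and
   [v^-1 g] is a point of [D] in [B]. *)
have [|p /PO/OVD[v V2v [d Dd <-]] [d' D'd' gE]] := Xg _ sPD oPD.
  by move=> x /XD' D'x; exists 1 => //; exists x => //; rewrite mul1g.
exists (d * d'); split; first by apply: DM => //; exact: D'D.
by have := V2B v V2v; rewrite /= -gE -mulgA mulKg.
Qed.
End Liminf.

End RIOTheory.

(** * Distal actions *)

Lemma ultra_fmap (S T : Type) (f : S -> T) (F : set_system S) :
  UltraFilter F -> UltraFilter (f @ F).
Proof.
move=> UF; split=> [|D PD FD]; first exact: fmap_proper_filter.
apply/seteqP; split=> A; last exact: FD.
move=> DA; have [//|FnA] := in_ultra_setVsetC (f @^-1` A) UF.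
have : D (A `&` ~` A) by apply: filterI => //; exact: FD.
by rewrite setICr => /filter_not_empty.
Qed.

(** * Pointwise limits of maps and idempotents *)

Section PointwiseConvergence.
Import ArrowAsProduct.
Variable X : topologicalType.
Implicit Types (f g : X -> X) (C S : set (X -> X)).

Lemma cvg_pointwise (T : Type) (F : set_system T) (g : T -> X -> X) f :
  Filter F -> (forall x, (fun t => g t x) @ F --> f x) -> g @ F --> f.
Proof.
move=> FF gf; apply/cvg_sup => x U [V [[W oW <-] Wfx WU]].
apply: (@filterS _ (g @ F) _ _ _ WU); apply: gf; exact: open_nbhs_nbhs.
Qed.

Lemma eval_continuous x : continuous (fun f : X -> X => f x).
Proof. exact: proj_continuous. Qed.

Lemma precomp_continuous g : continuous (fun f : X -> X => f \o g).
Proof.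
by move=> f; apply: (cvg_pointwise (nbhs_filter f)) => x /=; exact: eval_continuous.
Qed.

Lemma postcomp_continuous g :
  continuous g -> continuous (fun f : X -> X => g \o f).
Proof.
move=> cg f; apply: (cvg_pointwise (nbhs_filter f)) => x /=.
apply: (@continuous_comp _ _ _ (fun h : X -> X => h x) g); last exact: cg.
exact: eval_continuous.
Qed.

Definition comp_closed C : Prop := forall f g, C f -> C g -> C (f \o g).

(* The Ellis-Numakura lemma: if [S] is a minimal closed subsemigroup and
   [f \in S], then minimality forces [S \o f = S] and then
   [{s in S | s \o f = f} = S]. *)
Lemma idempotent_exists C :
  hausdorff_space X -> compact C -> C !=set0 -> comp_closed C ->
  exists2 f, C f & f \o f = f.
Proof.
move=> hX cC C0 CC.
have hXX : hausdorff_space (X -> X) by apply: hausdorff_product.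
pose P S := [/\ S `<=` C, closed S, S !=set0 & comp_closed S].
have PC : P C by split=> //; exact: compact_closed.
pose T := {S : set (X -> X) | P S}.
(* The order is reversed inclusion, so a maximal element for Zorn's lemma is a minimal closed
   subsemigroup. *)
pose R (S S' : T) := `[< sval S' `<=` sval S >].
have [||A totA|[S [SC clS S0 SS]] Smin] := @ZL_preorder T (exist P C PC) R.
- by move=> S; apply/asboolP.
- move=> S1 S2 S3 /asboolP S21 /asboolP S32; apply/asboolP.
  exact: subset_trans S21.
- have [[S0 AS0]|A0] := pselect (exists S : T, A S); last first.
    by exists (exist P C PC) => S AS; case: A0; exists S.
  pose F := [set sval S | S in A].
  have PF B : F B -> P B by move=> [[B' PB'] _ <-].
  have PI : P (\bigcap_(B in F) B).
    split.
    + by move=> f Ff; have [SC _ _ _] := svalP S0; apply: SC; apply: Ff; exists S0.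
    + by apply: closed_bigI => B /PF[].
    + apply: contrapT => I0.
      have fF : filtered F.
        split; first by exists (sval S0), S0.
        move=> _ _ [S1 AS1 <-] [S2 AS2 <-].
        have [/asboolP s|/asboolP s] := totA _ _ AS1 AS2.
          by exists (sval S2); [exists S2|move=> f Sf; split=> //; exact: s].
        by exists (sval S1); [exists S1|move=> f Sf; split=> //; exact: s].
      have clF B : F B -> closed B by move=> /PF[].
      have [f [_ If]|B FB CB] := filtered_compact_sub fF clF cC open0.
        by apply: I0; exists f.
      have [BC _ [f Bf] _] := PF B FB.
      by apply: (CB f); split=> //; exact: BC.
    + move=> f g Ff Fg B FB; have [_ _ _ BB] := PF B FB.
      by apply: BB; [exact: Ff|exact: Fg].
  exists (exist P _ PI) => S AS; apply/asboolP => f /= Ff; apply: Ff.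
  by exists S.
have {}Smin S' : S' `<=` S -> closed S' -> S' !=set0 -> comp_closed S' -> S `<=` S'.
  move=> S'S cl' S'0 SS'.
  have PS' : P S' by split=> //; exact: (subset_trans S'S SC).
  have := Smin (exist P S' PS'); rewrite /R /= => h.
  by apply/asboolP/h/asboolP.
have [f Sf] := S0.
have cS : compact S by exact: subclosed_compact SC.
have [s Ss sf] : [set s \o f | s in S] f.
  apply: (Smin _ _ _ _ _ f Sf).
  - by move=> _ [s Ss <-]; exact: SS.
  - apply: compact_closed => //; apply: continuous_compact => //.
    by apply: continuous_subspaceT; exact: precomp_continuous.
  - by exists (f \o f), f.
  - move=> _ _ [s Ss <-] [t St <-]; exists (s \o f \o t) => //.
    by apply: (SS) => //; exact: SS.
have [_ ff] : (S `&` [set s : X -> X | s \o f = f]) f.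
  apply: (Smin _ _ _ _ _ f Sf).
  - exact: subIsetl.
  - apply: closedI => //.
    have cf : closed [set f].
      exact: accessible_closed_set1 (hausdorff_accessible hXX) f.
    by move/continuous_closedP: (@precomp_continuous f) => /(_ _ cf).
  - by exists s.
  - move=> s1 s2 [Ss1 E1] [Ss2 E2]; split; first exact: SS.
    by rewrite /= -compA E2.
by exists f => //; exact: SC.
Qed.

End PointwiseConvergence.

Section DistalActions.
Local Open Scope group_scope.
Variables (G : topologicalGroupType) (X : topologicalType) (act : G -> X -> X).
Variable H : set G.
Implicit Types (x y z : X) (E K N Y : set X).

(** The neighbourhoods of [z], ordered by reverse inclusion, index the net that distality
    forbids. *)
Lemma distal_eq x y z :
  acts_distally H act ->
  (forall N, nbhs z N -> exists h, H h /\ (N (act h x) /\ N (act h y))) ->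
  x = y.
Proof.
move=> dist prox; apply: contrapT => xy.
pose I := {N : set X | nbhs z N}.
have [h hP] := choice (fun N : I => prox (sval N) (svalP N)).
pose le (N M : I) := sval M `<=` sval N.
apply: (dist x y z I le h); split=> //.
- split.
  + by constructor; exists setT; exact: filterT.
  + by move=> N t.
  + by move=> N1 N2 N3 s t; exact: (subset_trans t s).
  + move=> [N1 zN1] [N2 zN2]; have zN : nbhs z (N1 `&` N2) by exact: filterI.
    by exists (exist _ _ zN); split=> t [].
- by move=> N; have [] := hP N.
- move=> N zN; exists (exist _ N zN) => M NM /=.
  by apply: NM; have [_ []] := hP M.
- move=> N zN; exists (exist _ N zN) => M NM /=.
  by apply: NM; have [_ []] := hP M.
Qed.

Hypotheses (hausX : hausdorff_space X) (sgH : is_subgroup H)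
  (act1 : forall x, act 1 x = x)
  (actM : forall g h x, act (g * h) x = act g (act h x))
  (act_cont : continuous (fun p : G * X => act p.1 p.2))
  (distH : acts_distally H act).

Lemma act_continuous g : continuous (act g).
Proof.
move=> x; apply: (@continuous_comp _ _ _ (fun y => (g, y))
  (fun p : G * X => act p.1 p.2)); last exact: act_cont.
by apply: cvg_pair; [exact: cvg_cst|exact: cvg_id].
Qed.

Import ArrowAsProduct.

(* The limits of elements of [H] that map [z] and [E] into [E] form a compact
   semigroup of maps on [E] and [z]; an idempotent [f] there makes [z] and
   [f z] proximal. *)
Lemma distal_orbit_closure E z e :
  compact E -> (forall h x, H h -> E x -> E (act h x)) ->
  E e -> closure [set act h z | h in H] e -> E z.
Proof.
move=> cE EH Ee cle; apply: contrapT => nEz.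
have [H1 HM HV] := sgH.
(* Values off [E] and [z] are left free. This allows [Gam] to require values in [E] everywhere, so
   that Tychonoff's theorem applies although [X] need not be compact. *)
pose Phi := [set p : X -> X |
  exists2 h, H h & forall x, E x \/ x = z -> p x = act h x].
pose Gam := closure Phi `&` [set f : X -> X | forall x, E (f x)].
have cGam : compact Gam.
  rewrite /Gam setIC; apply: compact_closedI; last exact: closed_closure.
  exact: (@tychonoff X (fun=> X) (fun=> E)).
have GamM : comp_closed Gam.
  move=> f g [clf Ef] [clg Eg]; split; last by move=> x; exact: Ef.
  have PhiPhi h : H h -> forall p, Phi p -> Phi (act h \o p).
    move=> Hh p [u Hu pE]; exists (h * u); first exact: HM.
    by move=> x Dx /=; rewrite actM pE.
  apply: closed_closure.
  apply: (closure_preim (f := fun p : X -> X => p \o g)) clf.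
    exact: precomp_continuous.
  move=> p [h Hh pE]; rewrite (_ : p \o g = act h \o g); last first.
    by apply/funext => x /=; apply: pE; left; exact: Eg.
  apply: (closure_preim (f := fun p : X -> X => act h \o p)) clg.
    by apply: postcomp_continuous; exact: act_continuous.
  exact: PhiPhi.
have Gam0 : Gam !=set0.
  (* An ultrafilter finer than [F0] lives on [H], sends [z] to [e], and has a limit at each point of
     the compact invariant set [E]. *)
  pose F0 := filter_from (nbhs e) (fun N => [set h | H h /\ N (act h z)]).
  have FF0 : Filter F0.
    apply: filter_from_filter; first by exists setT; exact: filterT.
    move=> A B eA eB; exists (A `&` B); first exact: filterI.
    by move=> h [Hh [Ah Bh]].
  have PF0 : ProperFilter F0.
    apply: filter_from_proper => N /cle[_ [[h Hh <-] Nh]].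
    by exists h.
  have [F [UF FF]] := ultraFilterLemma PF0.
  have FH : F H by apply: FF; exists setT; [exact: filterT|move=> h []].
  have Fz : (fun h => act h z) @ F --> e.
    by move=> N eN; apply: FF; exists N => // h [].
  have lim x : exists y, E y /\ (E x -> (fun h => act h x) @ F --> y).
    have [Ex|nEx] := pselect (E x); last by exists e; split.
    have UFx : UltraFilter ((fun h => act h x) @ F) := ultra_fmap _ UF.
    have FE : ((fun h => act h x) @ F) E.
      by apply: (@filterS _ F _ _ _ _ FH) => h Hh; exact: EH.
    by move: cE; rewrite compact_ultra => /(_ _ UFx FE)[y [Ey Fy]]; exists y.
  have [f0 f0P] := choice lim.
  (* At [z], which is outside [E], the value [e] is the actual limit; elsewhere off [E] it is a
     filler in [E], matched by [p] below. *)
  pose f x := if `[< E x >] then f0 x else e.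
  exists f; split; last first.
    move=> x; rewrite /= /f; case: asboolP => // _.
    by have [] := f0P x.
  pose p h x := if `[< E x \/ x = z >] then act h x else e.
  have pf : p @ F --> (f : X -> X).
    apply: cvg_pointwise => x; rewrite /p /f.
    case: (asboolP (E x)) => [Ex|nEx].
      rewrite (_ : `[< _ >] = true); last by apply/asboolP; left.
      by have [_] := f0P x; apply.
    case: asboolP => [[//|->]|_] //; exact: cvg_cst.
  move=> B /pf FB.
  have FpB : F [set h | B (p h)] by exact: FB.
  have [h [Hh Bh]] : exists h, (H `&` [set h | B (p h)]) h.
    by apply: (@filter_ex _ F); exact: filterI.
  exists (p h); split=> //; exists h => // x Dx; rewrite /p.
  by case: asboolP.
have [f [clf Ef] ff] := idempotent_exists hausX cGam Gam0 GamM.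
apply: nEz; rewrite (_ : z = f z) //.
apply: (distal_eq (z := f z) distH) => N zN.
have ffz : f (f z) = f z by rewrite -[in RHS]ff.
(* Any [p] close to [f] sends both [z] and [f z] close to [f z]. For [p] in [Phi], an element of [H]
   does the same, since [f z] is in [E]. *)
have fN : nbhs (f : X -> X) [set p : X -> X | N (p z) /\ N (p (f z))].
  apply: filterI; first exact: (@eval_continuous X z f N zN).
  by apply: (@eval_continuous X (f z) f N); rewrite ffz.
have [p [[h Hh pE] [Nz Nfz]]] := clf _ fN.
by exists h; split=> //; split; rewrite -pE //; [right|left].
Qed.

End DistalActions.

(** * Invariant compact open sets *)

Lemma decreasing_compact (T : topologicalType) (K : set T) (W : nat -> set T) :
  compact K -> (forall n, closed (W n)) -> (forall n, W n.+1 `<=` W n) ->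
  (forall n, K `&` W n !=set0) -> exists x, K x /\ forall n, W n x.
Proof.
move=> cK clW Wdec KW; apply: contrapT => noW.
have Wle m n : m <= n -> W n `<=` W m.
  move=> /subnK <-; elim: (n - m) => [//|k IHk].
  by rewrite addSn; exact: subset_trans IHk.
have fF : filtered (range W).
  split; first by exists (W 0), 0.
  move=> _ _ [m _ <-] [n _ <-]; exists (W (maxn m n)); first by exists (maxn m n).
  by move=> x Wx; split; apply: Wle Wx; [exact: leq_maxl|exact: leq_maxr].
have clF A : range W A -> closed A by move=> [n _ <-].
have [x [Kx Wx]|_ [n _ <-] Wn] := filtered_compact_sub fF clF cK open0.
  by apply: noW; exists x; split=> // n; apply: Wx; exists n.
by have [x /Wn] := KW n.
Qed.

Section InvariantSets.
Local Open Scope group_scope.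
Variables (G : topologicalGroupType) (X : topologicalType) (act : G -> X -> X).
Hypotheses (hausX : hausdorff_space X)
  (act1 : forall x, act 1 x = x)
  (actM : forall g h x, act (g * h) x = act g (act h x))
  (act_cont : continuous (fun p : G * X => act p.1 p.2)).
Variables (K : set G) (Y : set X).
Hypotheses (cK : compact K) (distK : acts_distally (generated K) act)
  (cY : compact Y) (oY : open Y).

Let S : set G := K `|` [set k^-1 | k in K].

Let SV k : S k -> S k^-1.
Proof. by move=> [Kk|[k' Kk' <-]]; [right; exists k|left; rewrite invgK]. Qed.

Let SU : S `<=` generated K.
Proof.
have [_ _ UV] := generated_subgroup K.
move=> x [Kx|[k Kk <-]]; first exact: sub_generated.
by apply: UV; exact: sub_generated.
Qed.

Let cS : compact S.
Proof.
apply: compactU => //; apply: continuous_compact => //.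
by apply: continuous_subspaceT; exact: invg_continuous.
Qed.

Let image_act (A : set X) : set X := [set act p.1 p.2 | p in S `*` A].

Let image_act_compact A : compact A -> compact (image_act A).
Proof.
move=> cA; apply: continuous_compact; last exact: compact_setX.
by apply: continuous_subspaceT; exact: act_cont.
Qed.

Let iter_image_actS n A B : A `<=` B -> iter n image_act A `<=` iter n image_act B.
Proof.
move=> AB; elim: n => //= n IHn _ [[k x] [/= Sk /IHn Bx] <-].
by exists (k, x).
Qed.

(** These are the points kept in [Y] by all words of length at most [n] in the symmetric set [S].
    Dually, [iter n image_act] applies all words of length exactly [n]. *)
Let core_ (n : nat) : set X := iter n
  (fun A => A `&` [set x | forall k, S k -> A (act k x)]) Y.

Let core_sub n : core_ n `<=` Y.
Proof. by elim: n => [//|n IHn] x [/IHn]. Qed.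

Let core_open n : open (core_ n).
Proof.
elim: n => [|n IHn] //=; apply: openI => //.
apply: (open_forall_compact (f := fun x k => act k x)) => //.
move=> p; apply: (@continuous_comp _ _ _ (fun p : X * G => (p.2, p.1))
  (fun p : G * X => act p.1 p.2)); last exact: act_cont.
by apply: cvg_pair; [exact: cvg_snd|exact: cvg_fst].
Qed.

Let core_closed n : closed (core_ n).
Proof.
elim: n => [|n IHn] /=; first exact: compact_closed.
apply: closedI => //.
rewrite (_ : mkset _ = \bigcap_(k in S) (act k @^-1` core_ n)) //.
apply: closed_bigI => k _.
exact: (continuous_closedP _).1 (act_continuous act_cont (g := k)) _ IHn.
Qed.

(* Since [z] is close to every [core_ j] with a bound on the number of steps that
   does not depend on [m], a compactness argument can let [m] go to infinity. *)
Let core_exit m x : core_ m x -> ~ core_ m.+1 x ->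
  exists z, [/\ (image_act Y `\` Y) z,
    forall j, j <= m -> iter j.+1 image_act (core_ j) z &
    iter m.+1 image_act [set x] z].
Proof.
elim: m x => [|m IHm] x mx nmx.
  have [k Sk nkx] : exists2 k, S k & ~ Y (act k x).
    apply: contrapT => nk; apply: nmx; split=> // k Sk.
    by apply: contrapT => nY; apply: nk; exists k.
  exists (act k x); split=> [|[|//] _|].
  - by split=> //; exists (k, x).
  - by exists (k, x).
  - by exists (k, x).
have [k Sk nkx] : exists2 k, S k & ~ core_ m.+1 (act k x).
  apply: contrapT => nk; apply: nmx; split=> // k Sk.
  by apply: contrapT => nY; apply: nk; exists k.
have mkx : core_ m (act k x) by case: (mx) => _; exact.
have [z [Cz jz mz]] := IHm _ mkx nkx.
have {}mz : iter m.+2 image_act [set x] z.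
  rewrite iterSr; apply: iter_image_actS mz => _ ->.
  by exists (k, x).
(* For the new value [j = m.+1], the starting point [x] itself is the required point of
   [core_ j]. *)
exists z; split=> // j; rewrite leq_eqVlt => /orP[/eqP ->|]; last first.
  by rewrite ltnS; exact: jz.
by apply: iter_image_actS mz => _ ->.
Qed.

(** Since [S] is symmetric, the path leading to [z] can be walked backwards. *)
Let iter_image_act_orbit n A z :
  iter n image_act A z -> exists2 h, generated K h & A (act h z).
Proof.
have [U1 UM UV] := generated_subgroup K.
elim: n z => [|n IHn] z /=; first by exists 1; rewrite ?act1.
move=> [[k x] [/= Sk /IHn[h Uh Ahx]] <-].
exists (h * k^-1); first by apply: UM => //; apply: SU; exact: SV.
by rewrite -actM mulgVK.
Qed.

Lemma distal_open_invariant :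
  exists E, [/\ compact E, open E, E `<=` Y, K `<=` stabilizer act E &
    forall x, Y x -> (forall k, K k -> act k x = x) -> E x].
Proof.
pose E := \bigcap_n core_ n.
have EY : E `<=` Y by move=> x /(_ 0 I).
have ES k x : S k -> E x -> E (act k x).
  by move=> Sk Ex n _; have [_] := Ex n.+1 I; apply.
have KE : K `<=` stabilizer act E.
  by move=> k Kk; split=> x; apply: ES; [left|right; exists k].
have UE h x : generated K h -> E x -> E (act h x).
  move=> Uh; have [hE _] : stabilizer act E h; last exact: hE.
  by apply: generated_sub Uh => //; exact: stabilizer_subgroup.
have cE : compact E.
  by apply: (subclosed_compact _ cY) => //; apply: closed_bigI => n _.
exists E; split=> //; last first.
  move=> x Yx fixx n _; elim: n => [//|n IHn]; split=> // k [Kk|[k' Kk' <-]].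
    by rewrite fixx.
  by rewrite -(fixx k' Kk') -actM mulVg act1.
rewrite openE => e Ee; apply: contrapT => nE.
pose C := image_act Y `\` Y.
have cC : compact C.
  by apply: compact_closedI; [exact: image_act_compact|exact: open_closedC].
(* Quantifying over all [j <= n] makes these closed sets decrease, so compactness of [C] yields a
   single [z] outside [Y] that is reached from every [core_ j]. *)
pose W n := \bigcap_(j in [set j | j <= n]) iter j.+1 image_act (core_ j).
have core_compact n : compact (core_ n).
  exact: subclosed_compact (@core_closed n) cY (@core_sub n).
have iter_closed j n : closed (iter j image_act (core_ n)).
  apply: compact_closed => //.
  by elim: j => [|j IHj] //=; exact: image_act_compact.
have [|||z [Cz Wz]] := decreasing_compact (W := W) cC.
- by move=> n; apply: closed_bigI.
- by move=> n x Wx j /= jn; apply: Wx => /=; exact: leqW.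
- move=> n.
  have [x nx nEx] : exists2 x, core_ n x & ~ E x.
    apply: contrapT => nx; apply: nE.
    apply: (@filterS _ (nbhs e) _ (core_ n)).
      by move=> x nx'; apply: contrapT => nEx; apply: nx; exists x.
    by apply: open_nbhs_nbhs; split; [exact: core_open|exact: Ee].
  (* A point of [core_ n] outside [E] drops out of the cores at some [m >= n]; its exit point lies
     in [W n]. *)
  have [m nm [mx nmx]] : exists2 m, n <= m & core_ m x /\ ~ core_ m.+1 x.
    apply: contrapT => nom; apply: nEx => p _.
    have up q : core_ (q + n) x.
      elim: q => [//|q IHq]; apply: contrapT => nq; apply: nom.
      by exists (q + n); [exact: leq_addl|].
    have := up p; elim: n {nx nom up} => [|n IHn]; first by rewrite addn0.
    by rewrite addnS => -[/IHn].
  have [z [Cz jz _]] := core_exit mx nmx.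
  by exists z; split=> // j /= jn; apply: jz; exact: leq_trans nm.
(* The orbit of [z] meets every [core_ n], so by compactness its closure meets [E]. Distality then
   forces [z] into [E], against [z] being outside [Y]. *)
have [|||e' [Ye' We']] := decreasing_compact
  (W := fun n => closure [set act h z | h in generated K] `&` core_ n) cY.
- by move=> n; apply: closedI => //; exact: closed_closure.
- by move=> n; apply: setIS => x [].
- move=> n; have [h Uh nhz] := iter_image_act_orbit (Wz n n (leqnn n)).
  exists (act h z); split; first exact: core_sub nhz.
  by split=> //; apply: subset_closure; exists h.
have Ee' : E e' by move=> n _; have [] := We' n.
have cle' : closure [set act h z | h in generated K] e' by have [] := We' 0.
have Ez := distal_orbit_closure hausX (generated_subgroup K) actM act_cont distK
  cE (fun h x => @UE h x) Ee' cle'.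
by case: Cz => _; apply; exact: EY.
Qed.

End InvariantSets.

(** * Coset spaces *)

Section CosetAction.
Local Open Scope group_scope.
Local Open Scope quotient_scope.
Variables (G : topologicalGroupType) (H : set G) (sgH : is_subgroup H).

Let proj := lcoset_proj sgH.
Let act := lcoset_transl sgH.

Let act_proj g x : act g (proj x) = proj (g * x).
Proof. exact: lcoset_transl_proj. Qed.

Lemma lcoset_proj_continuous : continuous proj.
Proof. exact: pi_continuous. Qed.

Lemma lcoset_proj_surj q : exists x, q = proj x.
Proof.
by exists (repr (q : {eq_quot (lcoset_equiv sgH)})); rewrite /proj /lcoset_proj reprK.
Qed.

Lemma lcoset_proj_open V : open V -> open (proj @` V).
Proof.
move=> oV; rewrite /open /= /quotient_open.
rewrite (_ : _ @^-1` _ = \bigcup_(h in H) [set x | V (x * h)]).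
  by apply: bigcup_open => h _; exact: open_rtransl.
apply/seteqP; split=> x.
  move=> [v Vv /esym/lcoset_projP Hxv]; exists (x^-1 * v) => //=.
  by rewrite mulVKg.
move=> [h Hh Vxh]; exists (x * h) => //; apply/esym/lcoset_projP.
by rewrite mulKg.
Qed.

Lemma nbhs_lcoset_proj x A : nbhs x A -> nbhs (proj x) (proj @` A).
Proof.
rewrite (nbhsE x) => -[B [oB Bx] BA].
apply: (@filterS _ (nbhs (proj x)) _ (proj @` B)); first exact: image_subset.
by apply: open_nbhs_nbhs; split; [exact: lcoset_proj_open|exists x].
Qed.

Lemma lcoset_transl1 q : act 1 q = q.
Proof. by have [x ->] := lcoset_proj_surj q; rewrite act_proj mul1g. Qed.

Lemma lcoset_translM g h q : act (g * h) q = act g (act h q).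
Proof.
by have [x ->] := lcoset_proj_surj q; rewrite !act_proj mulgA.
Qed.

(** Joint continuity uses that the projection is open: it turns a neighbourhood in the second factor
    of [G * G] into one in the coset space. *)
Lemma lcoset_transl_continuous :
  continuous (fun p : G * lcoset_space sgH => act p.1 p.2).
Proof.
move=> [g q] /= W; have [x ->] := lcoset_proj_surj q.
rewrite act_proj => /lcoset_proj_continuous W'.
have [[A B] [/= gA xB] AB] := @mulg_continuous G (g, x) _ W'.
exists (A, proj @` B); first by split=> //=; exact: nbhs_lcoset_proj.
move=> [g' _] [/= Ag' [x' Bx' <-]] /=.
by rewrite act_proj; exact: (AB (g', x')).
Qed.

Lemma lcoset_space_hausdorff : closed H -> hausdorff_space (lcoset_space sgH).
Proof.
move=> clH p q; have [x ->] := lcoset_proj_surj p; have [y ->] := lcoset_proj_surj q.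
move=> clxy; apply/lcoset_projP; apply: contrapT => nH.
have c : continuous (fun p : G * G => p.1^-1 * p.2).
  apply: continuousMg; last exact: continuous_snd.
  by apply: continuousVg; exact: continuous_fst.
have /(c (x, y))[[A B] [/= xA yB] AB] : nbhs (x^-1 * y) (~` H).
  by apply: open_nbhs_nbhs; split=> //; exact: closed_openC.
have [_ [[a Aa <-] [b Bb /esym/lcoset_projP Hab]]] :=
  clxy _ _ (nbhs_lcoset_proj xA) (nbhs_lcoset_proj yB).
exact: (AB (a, b) (conj Aa Bb)).
Qed.

(** [K] fixes the base point, which therefore lies in the invariant set [E]. As [g] preserves [E],
    it lies in [V H] for arbitrarily small [V], hence in the closed subgroup [H]. *)
Lemma open_hull_distal_coset K :
  hausdorff_space G -> totally_disconnected [set: G] ->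
  locally_compact [set: G] ->
  closed H -> acts_distally H act -> compact K -> K `<=` H ->
  open_hull K `<=` H.
Proof.
move=> hausG tdG lcG clH distH cK KH g Kg; apply: (clH) => B Bg.
have [V [[V1 _ _] cV oV VB]] :=
  compact_open_subgroup hausG tdG lcG (nbhs_invg_transl Bg).
have UH : generated K `<=` H by exact: generated_sub.
have distK : acts_distally (generated K) act.
  move=> x y z I le h [xy dle hU hx hy].
  by apply: (distH x y z I le h); split=> // i; exact: UH.
have cY : compact (proj @` V).
  apply: continuous_compact => //; apply: continuous_subspaceT.
  exact: lcoset_proj_continuous.
have [E [cE oE EY KE fixE]] := distal_open_invariant
  (lcoset_space_hausdorff clH) lcoset_transl1 lcoset_translM
  lcoset_transl_continuous cK distK cY (lcoset_proj_open oV).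
have [gE _] : stabilizer act E g.
  apply: Kg => //.
    by apply: stabilizer_subgroup; [exact: lcoset_transl1|exact: lcoset_translM].
  by apply: stabilizer_open => //; exact: lcoset_transl_continuous.
have E1 : E (proj 1).
  apply: fixE; first by exists 1.
  move=> k Kk; rewrite act_proj; apply/lcoset_projP.
  by rewrite !mulg1; have [_ _ HV] := sgH; apply: HV; exact: KH.
have := EY _ (gE _ E1); rewrite act_proj mulg1 => -[v Vv /lcoset_projP Hvg].
by exists (v^-1 * g); split=> //; exact: VB.
Qed.

End CosetAction.

(** * Subnormal subgroups act distally *)

Section Subnormal.
Local Open Scope group_scope.
Variable G : topologicalGroupType.
Implicit Types H N : set G.

(** Induction along the series puts [n] in the closure of [N], so [w ^ n] is in the closure of [H]
    for [w] in [H]. Then [n^-1 (w n v) = w ^ n * v] is there too, and letting [w n v] tend to 1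
    gives [n^-1]. *)
Lemma subnormal_double_coset H n :
  subnormal H -> closure [set w * n * v | w in H & v in H] 1 -> closure H n.
Proof.
move=> snH; elim: snH => {H} [|H N snN IHN [[H1 HM HV] HN nHN]] cl1.
  by rewrite closureT.
have Nn : closure N n.
  apply: IHN; apply: closureS cl1 => _ [w Hw [v Hv <-]].
  by exists w; [exact: HN|exists v => //; exact: HN].
have conjH w : H w -> closure H (w ^ n).
  move=> Hw; apply: (closure_preim (f := fun x => w ^ x)) Nn => [|x Nx]; last exact: nHN.
  rewrite (_ : (fun x => _) = fun x => x^-1 * (w * x)); last first.
    by apply/funext => x; rewrite conjgE.
  apply: continuousMg; first exact: invg_continuous.
  by apply: continuousMg; [exact: cst_continuous|exact: continuous_idfun].
have [_ cM cV] := closure_subgroup (And3 H1 HM HV).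
rewrite -(invgK n) -(mulg1 n^-1); apply: cV.
apply: closed_closure; apply: (closure_preim (f := fun x => n^-1 * x)) cl1.
  by apply: continuousMg; [exact: cst_continuous|exact: continuous_idfun].
move=> _ [w Hw [v Hv <-]].
rewrite (_ : _ * _ = w ^ n * v); last by rewrite conjgE !mulgA.
by apply: cM; [exact: conjH|exact: subset_closure].
Qed.

Lemma subnormal_distal H (sgH : is_subgroup H) :
  closed H -> subnormal H -> acts_distally H (lcoset_transl sgH).
Proof.
move=> clH snH x y z I le h [xy [_ _ _ le_ub] Hh hx hy]; apply: xy; move: hx hy.
have [a ->] := lcoset_proj_surj x; have [b ->] := lcoset_proj_surj y.
have [c ->] := lcoset_proj_surj z => hx hy.
apply/lcoset_projP; apply: clH; apply: subnormal_double_coset => // W W1.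
have cont : continuous (fun p : G * G => p.1^-1 * p.2).
  apply: continuousMg; last exact: continuous_snd.
  by apply: continuousVg; exact: continuous_fst.
have /(cont (1, 1))[[A B] [/= A1 B1] AB] : nbhs ((1 : G)^-1 * 1) W by rewrite mulVg.
have tr (V : set G) : nbhs 1 V -> nbhs c [set t | V (c^-1 * t)].
  move=> V1; have cc : continuous (fun t => c^-1 * t).
    by apply: continuousMg; [exact: cst_continuous|exact: continuous_idfun].
  by apply: cc; rewrite mulVg.
have [i hi] := hx _ (nbhs_lcoset_proj sgH (tr A A1)).
have [j hj] := hy _ (nbhs_lcoset_proj sgH (tr B B1)).
have [k [ik jk]] := le_ub i j.
have := hi k ik; have := hj k jk; rewrite /= !lcoset_transl_proj.
move=> [t' Bt' /esym/lcoset_projP Hbt'] [t At /esym/lcoset_projP Hat].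
have [_ _ HV] := sgH.
(* The points [t] of [h k a H] and [t'] of [h k b H] are both near [c], so [t^-1 t'] is near 1; it
   lies in the double coset of [a^-1 b] because [h k] cancels. *)
exists (t^-1 * t'); split; last first.
  by have := AB (c^-1 * t, c^-1 * t') (conj At Bt'); rewrite /= invgM invgK mulgA mulgK.
exists ((h k * a)^-1 * t)^-1; first exact: HV.
exists ((h k * b)^-1 * t') => //.
by rewrite !invgM !invgK !mulgA !mulgK.
Qed.

End Subnormal.

Theorem theorem5 (G : topologicalGroupType)
    (hausG : hausdorff_space G)
    (tdG : totally_disconnected [set: G])
    (lcG : locally_compact [set: G]) :
  (* (i) *)
  [/\ (forall (H : set G) (sgH : is_subgroup H), closed H ->
         acts_distally H (lcoset_transl sgH) -> RIO [set: G] H)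
      /\ (forall (H : set G) (sgH : is_subgroup H), closed H ->
         subnormal H -> acts_distally H (lcoset_transl sgH)),
  (* (ii) *)
      (forall H K : set G, RIO [set: G] H -> RIO H K -> RIO [set: G] K),
  (* (iii) *)
      (forall F : set (set G), (forall H, F H -> RIO [set: G] H) ->
         RIO [set: G] (\bigcap_(H in F) H)) &
  (* (iv) *)
      (forall (I : Type) (le : I -> I -> Prop) (H_ : I -> set G),
         directed_set le -> (forall i, RIO [set: G] (H_ i)) ->
         RIO [set: G] (closure (net_liminf le H_)))].
Proof.
split.
- split=> H sgH clH; last exact: subnormal_distal.
  move=> distH; apply: RIO_of_open_hull => // K cK KH.
  exact: open_hull_distal_coset.
- exact: RIO_trans.
- exact: RIO_bigcap.
- by move=> I le H_ dle rH; exact: RIO_closure_liminf.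
Qed.
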